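(* Let $r\ge4$ and $k\ge0$ be an integer. For every advice-based contract schedule with untrusted advice of size $k$ whose robustness is at most $r$, its consistency is at least \[ \min\Big\{\frac{x^{2^k+1}}{x^{2^k}-1}\ :\ \zeta_{1,r}^{1/2^k}\le x\le \zeta_{2,r}^{1/2^k}\Big\}. \]
   Context: A single-processor contract schedule is a strictly increasing sequence $X=(x_i)_{i\ge0}$ of positive reals, the contracts run back to back from time $0$ (contract $i$ completes at time $\sum_{j\le i}x_j$); for an interruption time $T$, $\ell(X,T)$ is the largest length of a contract completed by time $T$ (with $T/\ell=\infty$ if none), and the acceleration ratio of $X$ is $\sup_{T\ge x_0}T/\ell(X,T)$. An advice-based schedule with advice of size $k$ is a map assigning to each advice string $\sigma\in\{0,1\}^k$ a single-processor schedule $X_\sigma$; the advice $\sigma$ is supplied by an oracle that knows the interruption time $T$, and the schedule $X_\sigma$ is executed. Its robustness (performance under adversarially chosen advice) is $\max_\sigma$ of the acceleration ratio of $X_\sigma$. Its consistency (performance under error-free advice) is $\sup_{T\ge T_0}\min_\sigma T/\ell(X_\sigma,T)$, where $T_0=\max_\sigma$ (first contract length of $X_\sigma$). For $r\ge4$, $\zeta_{1,r}=\frac{r-\sqrt{r^2-4r}}{2}$ and $\zeta_{2,r}=\frac{r+\sqrt{r^2-4r}}{2}$. *)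

(* Defs.v *)
From HB Require Import structures.
From mathcomp Require Import all_boot all_order all_algebra.
From mathcomp Require Import all_classical all_reals all_analysis.

Set Implicit Arguments.
Unset Strict Implicit.
Unset Printing Implicit Defensive.

Import Order.TTheory GRing.Theory Num.Theory.

Local Open Scope classical_set_scope.
Local Open Scope ring_scope.

Record schedule (R : realType) := Schedule {
  contract :> nat -> R;
  contract_gt0 : forall i, 0 < contract i;
  contract_increasing : {homo contract : i j / (i < j)%N >-> i < j} }.

Section SingleSchedule.
Context {R : realType}.
Implicit Types (X : schedule R) (T : R).

Definition completion X (i : nat) : R := \sum_(j < i.+1) X j.

(* The set below is finite, because completion X i >= X 0 *+ i.+1. When it is
   nonempty its supremum is therefore its largest element; when it is empty
   the value 0 is never used. *)
Definition longest_completed X T : R :=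
  sup [set X i | i in [set i | completion X i <= T]].

Definition interruption_ratio X T : \bar R :=
  if `[< exists i, completion X i <= T >]
  then (T / longest_completed X T)%:E else +oo%E.

Definition acceleration_ratio X : \bar R :=
  ereal_sup [set interruption_ratio X T | T in [set T | X 0%N <= T]].

End SingleSchedule.

(* An advice string is a k-tuple of bits. *)
Definition advice_schedule (R : realType) (k : nat) := k.-tuple bool -> schedule R.

Section AdviceSchedule.
Context {R : realType} {k : nat}.
Implicit Type X : advice_schedule R k.

Definition robustness X : \bar R :=
  \big[maxe/-oo%E]_(s : k.-tuple bool) acceleration_ratio (X s).

(* First contract lengths are positive, so the neutral element 0 is harmless. *)
Definition start_time X : R :=
  \big[Num.max/0]_(s : k.-tuple bool) X s 0%N.

Definition consistency X : \bar R :=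
  ereal_sup [set \big[mine/+oo%E]_(s : k.-tuple bool) interruption_ratio (X s) T
            | T in [set T | start_time X <= T]].

End AdviceSchedule.

Definition zeta1 {R : realType} (r : R) : R := (r - Num.sqrt (r ^+ 2 - 4 * r)) / 2.
Definition zeta2 {R : realType} (r : R) : R := (r + Num.sqrt (r ^+ 2 - 4 * r)) / 2.

Definition is_minimum {R : realType} (A : set R) (m : R) : Prop := A m /\ lbound A m.

(* Main.v *)
(* Let [n = 2 ^ k] and let [S i] be the completion times of one of the [n]
   schedules, so that [X i = S i - S i.-1]. If the consistency is below [c],
   then every large time [T] has some [S i < T <= c * X i], that is, with
   [q = S i / S i.-1],
     [ln T - ln (S i) <= ln c + ln (1 - q^-1)].
   Iterate this, replacing [T] by [S i]. The logarithms [ln q] that occur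
   telescope along each schedule, so they sum to at most [n] times the total
   decrease of [ln T]. As [ln (1 - q^-1)] is concave in [ln q], it lies below
   its tangent at [u = min (zeta2 r) (n + 1)], whose slope is
   [1 / (u - 1) = 1 / n + d] with [d >= 0]. The part of slope [1 / n] is
   absorbed by telescoping; the rest vanishes when [u = n + 1], and when
   [u = zeta2 r] it is controlled because robustness [r] forces [q] to be
   eventually at most [zeta2 r + eta]. This gives
   [ln c >= ln u / n - ln (1 - u^-1)], the value of the objective at
   [x = u ^ (1 / n)], which the same tangent inequality shows to be minimal. *)
Require Import Defs.
From HB Require Import structures.
From mathcomp Require Import all_boot all_order all_algebra.
From mathcomp Require Import all_classical all_reals all_analysis.
From mathcomp Require Import ring lra.

Set Implicit Arguments.
Unset Strict Implicit.
Unset Printing Implicit Defensive.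

Import Order.TTheory GRing.Theory Num.Theory.

Local Open Scope classical_set_scope.
Local Open Scope ring_scope.

(** * Real inequalities, the ratio recurrence and the potential argument *)

Section Analysis.
Context {R : realType}.
Implicit Types (r x u z c : R) (rho : nat -> R).

Lemma unbounded_lt (a b C : R) : 0 < b -> exists N : nat, C < a + b *+ N.
Proof.
move=> b0; exists (Num.truncn ((C - a) / b)).+1.
by rewrite addrC -ltrBlDr -mulr_natl -ltr_pdivrMr // truncnS_gt.
Qed.

Lemma powR_rootK (n : nat) x : (0 < n)%N -> 0 <= x ->
  (x `^ (1 / n%:R)) ^+ n = x.
Proof.
move=> n0 x0; have nR0 : n%:R != 0 :> R by rewrite pnatr_eq0 -lt0n.
by rewrite -powR_mulrn ?powR_ge0// -powRrM (divfK nR0) powRr1.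
Qed.

(* With [a = ln x - ln u], exponentiate and use [expR y >= 1 + y] at [- a] and
   at [a / (u - 1)], with weights [1] and [u - 1]. *)
Lemma ln_1subV_tangent u x : 1 < u -> 1 < x ->
  ln (1 - x^-1) <= ln (1 - u^-1) + (ln x - ln u) / (u - 1).
Proof.
move=> u1 x1; set a := ln x - ln u.
have u0 : 0 < u by lra.
have x0 : 0 < x by lra.
have um0 : 0 < u - 1 by lra.
have q0 : 0 < 1 - u^-1 by rewrite subr_gt0 invf_lt1.
have p0 : 0 < 1 - x^-1 by rewrite subr_gt0 invf_lt1.
have xE : x^-1 = expR (- a) / u.
  by rewrite -[x in LHS]lnK ?posrE// -expRN -[X in _ / X]lnK ?posrE// -expRN
    -expRD /a opprB; congr expR; ring.
rewrite -ler_expR expRD !lnK ?posrE// xE.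
have e1 := expR_ge1Dx (- a); have e2 := expR_ge1Dx (a / (u - 1)).
have -> : 1 - u^-1 = (u - 1) / u by field; rewrite gt_eqF.
have -> : 1 - expR (- a) / u = (u - expR (- a)) / u by field; rewrite gt_eqF.
rewrite mulrAC ler_pM2r ?invr_gt0//.
have : (u - 1) * (1 + a / (u - 1)) <= (u - 1) * expR (a / (u - 1)).
  by rewrite ler_pM2l.
have -> : (u - 1) * (1 + a / (u - 1)) = u - 1 + a by field; rewrite gt_eqF.
lra.
Qed.

(** The zetas are the roots of [x ^+ 2 - r * x + r]. With [d] the square root of the discriminant,
    [1 < zeta1 r <= 2] amounts to [r - 4 <= d < r - 2]. *)
Lemma zeta_props r : 4 <= r ->
  [/\ zeta1 r + zeta2 r = r, zeta1 r * zeta2 r = r, 1 < zeta1 r,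
      zeta1 r <= 2 & zeta1 r <= zeta2 r].
Proof.
move=> r4; rewrite /zeta1 /zeta2.
have D0 : 0 <= r ^+ 2 - 4 * r by rewrite expr2 -mulrBl mulr_ge0//; lra.
have := sqr_sqrtr D0; have := sqrtr_ge0 (r ^+ 2 - 4 * r).
set d := Num.sqrt _ => d0; rewrite !expr2 => dd.
have dr : d < r - 2 by rewrite ltNge; apply/negP => H; nra.
have rd : r - 4 <= d by rewrite leNgt; apply/negP => H; nra.
split; [by field | | lra.. ].
by rewrite mulrACA mulrC; lra.
Qed.

(* Above [z > zeta2 r] the map [x |-> r - r / x] decreases its argument by at
   least a fixed amount, and it preserves [0 < x <= z]. *)
Lemma ratio_eventually_le r rho z : 4 <= r -> zeta2 r < z ->
  (forall i, 0 < rho i) -> (forall i, rho i.+1 <= r - r / rho i) ->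
  exists I, forall i, (I <= i)%N -> rho i <= z.
Proof.
move=> r4 zz rho0 rhoS; have [zD zM z1 _ z12] := zeta_props r4.
have z0 : 0 < z by lra.
(* [x - (r - r / x) = (x - zeta2 r) * (x - zeta1 r) / x] is least at [z] among [x >= z]; [b] is that
   value. *)
set b := (z - zeta2 r) * (z - zeta1 r) / z.
have b0 : 0 < b by rewrite divr_gt0// mulr_gt0; lra.
have dec x : z <= x -> r - r / x <= x - b.
  move=> zx; have x0 : 0 < x by lra.
  rewrite -(ler_pM2r x0) !mulrBl divfK ?gt_eqF//.
  have : b * x <= (z - zeta2 r) * (x - zeta1 r).
    rewrite /b mulrAC ler_pdivrMr// -!mulrA ler_pM2l; last lra.
    nra.
  have : (z - zeta2 r) * (x - zeta1 r) <= (x - zeta2 r) * (x - zeta1 r).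
    by rewrite ler_pM2r; lra.
  have : r * x = (zeta1 r + zeta2 r) * x by rewrite zD.
  have : r = zeta1 r * zeta2 r by rewrite zM.
  lra.
have [I hI] : exists I, rho I <= z.
  apply: contrapT => /forallNP H.
  have {}H i : z < rho i by rewrite ltNge; apply/negP/H.
  have rhoN N : rho N <= rho 0%N - b *+ N.
    elim: N => [|N IH]; first by rewrite subr0.
    apply: le_trans (rhoS N) _; apply: le_trans (dec _ (ltW (H N))) _.
    by rewrite mulrS; lra.
  have [N hN] := unbounded_lt 0 (rho 0%N) b0.
  by have := rhoN N; have := rho0 N; lra.
exists I => i /subnK <-; elim: (i - I)%N => // j IH; rewrite addSn.
apply: le_trans (rhoS _) _.
have rj := rho0 (j + I)%N.
have : r / z <= r / rho (j + I)%N.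
  by rewrite ler_pM2l; [rewrite lef_pV2 ?posrE | lra].
have := dec z (lexx z); lra.
Qed.

(** The tangent at [u] has slope [1 / n + d], with [d >= 0] because [u <= n + 1]. Anchoring the [d]
    term at [ln z] makes it nonpositive for [x <= z]. *)
Lemma ln_1subV_bound z (n : nat) : 1 < z -> (0 < n)%N ->
  let u := Num.min z n.+1%:R in
  exists2 d : R, 0 <= d & forall x, 1 < x ->
    ln (1 - x^-1) <= ln x / n%:R - (ln u / n%:R - ln (1 - u^-1))
                     + d * (ln x - ln z).
Proof.
move=> z1 n0 u.
have nR0 : 0 < n%:R :> R by rewrite ltr0n.
have u1 : 1 < u by rewrite lt_min z1 ltr1n.
have um0 : 0 < u - 1 by rewrite subr_gt0.
exists ((u - 1)^-1 - n%:R^-1).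
  rewrite subr_ge0 lef_pV2 ?posrE// lerBlDr -[1]/(1%:R) -natrD addn1.
  by rewrite ge_min lexx orbT.
(* Either [u = z], or [u = n + 1] and the coefficient vanishes. *)
have uz : ((u - 1)^-1 - n%:R^-1) * ln z = ((u - 1)^-1 - n%:R^-1) * ln u.
  rewrite /u; case: leP => // _.
  by rewrite -[n.+1]addn1 natrD addrK subrr !mul0r.
move=> x x1; rewrite mulrBr uz.
apply: le_trans (ln_1subV_tangent u1 x1) _.
rewrite le_eqVlt; apply/orP; left; apply/eqP.
by field; rewrite !gt_eqF.
Qed.

Lemma ex_switch (P : pred nat) : ~~ P 0%N -> (exists i, P i) ->
  exists i, ~~ P i /\ P i.+1.
Proof.
move=> P0 exP; case: (ex_minnP exP) => -[|i] Pi iP; first by rewrite Pi in P0.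
by exists i; split=> //; apply/negP => /iP; rewrite ltnn.
Qed.

(* Potential argument: with [S s (l s T)] the last value of [S s] below [T],
   [U T] is [ln T] minus the average over [s] of [ln (S s (l s T))]. It lies
   in [0, ln r], while stepping from [T] down to [S s i.+1] raises it by [a]. *)
Lemma no_descending_steps (I : finType) (S : I -> nat -> R) r c T1 a :
  (0 < #|I|)%N -> (forall s i, 0 < S s i) ->
  (forall s, {homo S s : i j / (i < j)%N >-> i < j}) ->
  (forall s C, exists i, C < S s i) ->
  (forall s i, S s i.+1 <= r * S s i) ->
  (forall s, S s 0%N < T1) -> 0 < T1 -> 1 < c -> 0 < a ->
  (forall T, T1 <= T -> exists s i, [/\ S s i.+1 < T, T <= c * S s i.+1 &
     ln T - ln (S s i.+1) <= (ln (S s i.+1) - ln (S s i)) / #|I|%:R - a]) ->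
  False.
Proof.
move=> I0 S0 Slt Sunb Sr ST1 T10 c1 a0 step.
have nR0 : 0 < #|I|%:R :> R by rewrite ltr0n.
have Sle s i j : (i <= j)%N -> S s i <= S s j.
  by rewrite leq_eqVlt => /orP[/eqP->//|/Slt/ltW].
have Sinv s i j : S s i < S s j -> (i < j)%N.
  by move=> ij; rewrite ltnNge; apply/negP => /(Sle s); rewrite leNgt ij.
have lnS s i j : (i <= j)%N -> ln (S s i) <= ln (S s j).
  by move=> ij; rewrite ler_ln ?posrE// Sle.
(* For [T <= S s 0] the index is a dummy [0]; [ST1] rules this case out from [T1] on. *)
have /choice[l lP] (p : I * R) : exists i,
    S p.1 0%N < p.2 -> S p.1 i < p.2 <= S p.1 i.+1.
  case: (ltP (S p.1 0%N) p.2) => p0; last by exists 0%N.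
  have [||i [i1 i2]] := @ex_switch (fun i => p.2 <= S p.1 i).
  - by rewrite -ltNge.
  - by have [i /ltW] := Sunb p.1 p.2; exists i.
  - by exists i => _; rewrite ltNge i1.
have {}lP s T : T1 <= T -> S s (l (s, T)) < T <= S s (l (s, T)).+1.
  by move=> T1T; apply: (lP (s, T)) => /=; apply: lt_le_trans (ST1 s) _.
have le_l s T j : T1 <= T -> S s j < T -> (j <= l (s, T))%N.
  move=> /(lP s)/andP[_ Tl] jT; rewrite -ltnS; apply: (Sinv s).
  exact: lt_le_trans jT Tl.
pose V T := \sum_s ln (S s (l (s, T))).
pose U T := ln T - V T / #|I|%:R.
have const x : \sum_(s : I) x = x * #|I|%:R by rewrite sumr_const mulr_natr.
have U_ge0 T : T1 <= T -> 0 <= U T.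
  move=> T1T; rewrite subr_ge0 ler_pdivrMr// -const ler_sum// => s _.
  have /andP[lT _] := lP s _ T1T.
  by rewrite ler_ln ?posrE ?(ltW lT)// (lt_le_trans T10).
have U_le T : T1 <= T -> U T <= ln r.
  move=> T1T; rewrite lerBlDl -lerBlDr ler_pdivlMr// -const ler_sum// => s _.
  have /andP[_ Tl] := lP s _ T1T; have T0 := lt_le_trans T10 T1T.
  have := le_trans Tl (Sr s _); have Sl := S0 s (l (s, T)).
  move=> Trl; have r0 : 0 < r by rewrite -(pmulr_lgt0 _ Sl) (lt_le_trans T0).
  by rewrite lerBlDl -lnM ?posrE// ler_ln ?posrE// mulr_gt0.
(* A step divides [T] by at most [c], so [T >= c ^+ N * T1] leaves room for [N] steps, each raising
   [U] by at least [a]. *)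
have UN N T : c ^+ N * T1 <= T -> U T <= ln r - a *+ N.
  elim: N T => [|N IH] T; first by rewrite mul1r subr0; apply: U_le.
  move=> cT; have cN1 : 1 <= c ^+ N.+1 by rewrite exprn_ege1// ltW.
  have cN : 1 <= c ^+ N by rewrite exprn_ege1// ltW.
  have T1T : T1 <= T by apply: le_trans cT; rewrite ler_peMl// ltW.
  have [s [i [St Tc Td]]] := step T T1T.
  set t := S s i.+1 in St Tc Td.
  have ct : c ^+ N * T1 <= t.
    rewrite -(ler_pM2l (lt_trans ltr01 c1)) mulrA -exprS.
    exact: le_trans Tc.
  have T1t : T1 <= t by apply: le_trans ct; rewrite ler_peMl// ltW.
  (* Along [s] the last index is at least [i.+1] at [T] and at most [i] at [t]; along the other
     sequences it does not grow from [T] down to [t]. *)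
  have VTt : ln t - ln (S s i) <= V T - V t.
    rewrite /V -sumrB (bigD1 s)//= -[leLHS]addr0 lerD//.
      rewrite lerB// lnS//; first exact: le_l.
      by rewrite -ltnS; apply: (Sinv s); have /andP[] := lP s _ T1t.
    apply: sumr_ge0 => s' _; rewrite subr_ge0 lnS// le_l//.
    by apply: lt_trans St; have /andP[] := lP s' _ T1t.
  have := IH _ ct; rewrite /U mulrS.
  have : (ln t - ln (S s i)) / #|I|%:R <= (V T - V t) / #|I|%:R.
    by rewrite ler_pM2r// invr_gt0.
  rewrite !mulrBl; lra.
have [N hN] := unbounded_lt 0 (ln r) a0.
have cN : 1 <= c ^+ N by rewrite exprn_ege1// ltW.
have := U_ge0 (c ^+ N * T1); rewrite ler_peMl// ?(ltW T10)// => /(_ isT).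
have := UN N _ (lexx _); lra.
Qed.

End Analysis.

(** * Completion times of a single schedule *)

Section Schedule.
Context {R : realType}.
Implicit Types (X : schedule R) (T r : R).

Lemma completion0 X : completion X 0 = X 0%N.
Proof. by rewrite /completion big_ord1. Qed.

Lemma completionS X i : completion X i.+1 = completion X i + X i.+1.
Proof. by rewrite /completion big_ord_recr. Qed.

Lemma contract_le X i j : (i <= j)%N -> X i <= X j.
Proof. by rewrite leq_eqVlt => /orP[/eqP->//|/contract_increasing/ltW]. Qed.

Lemma completion_lt X : {homo completion X : i j / (i < j)%N >-> i < j}.
Proof.
apply: homo_ltn => [y x z|i]; first exact: lt_trans.
by rewrite completionS ltrDl contract_gt0.
Qed.

Lemma completion_le X i j : (i <= j)%N -> completion X i <= completion X j.
Proof. by rewrite leq_eqVlt => /orP[/eqP->//|/completion_lt/ltW]. Qed.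

Lemma completion_gt0 X i : 0 < completion X i.
Proof.
apply: lt_le_trans (completion_le X (leq0n i)).
by rewrite completion0 contract_gt0.
Qed.

Lemma contract_le_completion X i : X i <= completion X i.
Proof.
case: i => [|i]; first by rewrite completion0.
by rewrite completionS lerDr ltW// completion_gt0.
Qed.

Lemma completion_unbounded X C : exists i, C < completion X i.
Proof.
have [N hN] := unbounded_lt 0 C (contract_gt0 X 0%N); exists N.
apply: lt_le_trans hN _; rewrite add0r.
elim: N => [|N IH]; first by rewrite mulr0n ltW// completion_gt0.
by rewrite mulrSr completionS lerD// contract_le.
Qed.

Lemma ex_last_completed X T : X 0%N <= T ->
  exists i, completion X i <= T < completion X i.+1.
Proof.
move=> X0T; have [||i [i1 i2]] := @ex_switch (fun i => T < completion X i).
- by rewrite -leNgt completion0.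
- exact: completion_unbounded.
- by exists i; rewrite leNgt i1.
Qed.

(** Contract lengths increase, so the last completed contract attains the supremum. *)
Lemma longest_completedE X T i : completion X i <= T < completion X i.+1 ->
  longest_completed X T = X i.
Proof.
move=> /andP[iT Ti].
have ubX : ubound [set X i | i in [set i | completion X i <= T]] (X i).
  move=> _ [j /= jT <-]; apply: contract_le; rewrite leqNgt; apply/negP.
  by move=> /(completion_le X); rewrite leNgt (le_lt_trans jT).
apply/eqP; rewrite eq_le; apply/andP; split.
  by apply: ge_sup => //; exists (X i), i.
by apply: ub_le_sup; [exists (X i) | exists i].
Qed.

Lemma interruption_ratio_le X T r : (interruption_ratio X T <= r%:E)%E ->
  exists2 i, completion X i <= T & T <= r * X i.
Proof.
rewrite /interruption_ratio; case: asboolP => // -[j jT].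
have [|i iP] := @ex_last_completed X T.
  by apply: le_trans jT; rewrite -completion0 completion_le.
rewrite (longest_completedE iP) lee_fin ler_pdivrMr ?contract_gt0// => Tr.
by exists i => //; have /andP[] := iP.
Qed.

(** An interruption just before contract [i.+1] completes finds nothing longer than [X i]
    finished. *)
Lemma acceleration_ratio_le X r : (acceleration_ratio X <= r%:E)%E ->
  forall i, completion X i.+1 <= r * X i.
Proof.
move=> Xr i; rewrite leNgt; apply/negP => rS.
have Si := completion_lt X (ltnSn i).
set a := completion X i in Si; set b := completion X i.+1 in rS Si.
(* This midpoint exceeds [r * X i] and still lies between [a] and [b]. *)
pose T := (Num.max (r * X i) a + b) / 2.
have mb : Num.max (r * X i) a < b by rewrite gt_max rS.
have ma : a <= Num.max (r * X i) a by rewrite le_max lexx orbT.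
have mr : r * X i <= Num.max (r * X i) a by rewrite le_max lexx.
have aT : a <= T by rewrite /T; lra.
have Tb : T < b by rewrite /T; lra.
have : (interruption_ratio X T <= r%:E)%E.
  apply: le_trans Xr; apply: ereal_sup_ubound; exists T => //=.
  by apply: le_trans aT; rewrite -completion0 completion_le.
move=> /interruption_ratio_le[j jT Tj].
have ji : (j <= i)%N.
  rewrite leqNgt; apply/negP => /(completion_le X).
  by rewrite leNgt (le_lt_trans jT).
have r0 : 0 < r.
  rewrite -(pmulr_lgt0 _ (contract_gt0 X j)); apply: lt_le_trans Tj.
  exact: lt_le_trans (completion_gt0 X j) jT.
have : r * X j <= r * X i by rewrite ler_pM2l// contract_le.
rewrite /T in Tj; lra.
Qed.

(** Since [X i.+1] is the difference of consecutive completion times, successive ratios [q], [q'] of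
    these times satisfy [q' <= r - r / q]. *)
Lemma ln_completion_ratio_eventually_le X r e : 4 <= r -> 0 < e ->
  (acceleration_ratio X <= r%:E)%E ->
  exists I, forall i, (I <= i)%N ->
    ln (completion X i.+1) - ln (completion X i) <= ln (zeta2 r) + e.
Proof.
move=> r4 e0 /acceleration_ratio_le Xr.
have [_ _ z1 _ z12] := zeta_props r4.
have S0 := completion_gt0 X; have z0 : 0 < zeta2 r by lra.
have [|i|i|I IP] := @ratio_eventually_le R r
    (fun i => completion X i.+1 / completion X i) (zeta2 r * expR e) r4.
- by rewrite ltr_pMr// expR_gt1.
- by rewrite divr_gt0.
- rewrite invf_div ler_pdivrMr// mulrBl mulrA divfK ?gt_eqF//.
  rewrite -mulrBr; suff -> : completion X i.+1 - completion X i = X i.+1 by [].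
  by rewrite completionS addrAC subrr add0r.
exists I => i /IP rhoI; have e1 := expR_gt0 e.
have : ln (completion X i.+1 / completion X i) <= ln (zeta2 r * expR e).
  by rewrite ler_ln ?posrE ?divr_gt0// (mulr_gt0 z0).
rewrite ln_div ?posrE//.
have -> : ln (zeta2 r * expR e) = ln (zeta2 r) + e by rewrite lnM ?posrE ?expRK.
by [].
Qed.

End Schedule.

(** * Lower bound on the logarithm of the consistency *)

Section Advice.
Context {R : realType} {k : nat}.
Implicit Types (X : advice_schedule R k) (r c M : R).

Lemma consistency_le X c : (consistency X <= c%:E)%E ->
  forall T, start_time X <= T ->
  exists s, exists2 i, completion (X s) i <= T & T <= c * X s i.
Proof.
move=> Xc T T0.
have /bigmin_leP[|[s _]] : (\big[mine/+oo]_(s : k.-tuple bool)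
    interruption_ratio (X s) T <= c%:E)%E.
- by apply: le_trans Xc; apply: ereal_sup_ubound; exists T.
- by [].
- by exists s; exact: interruption_ratio_le.
Qed.

Lemma robustness_ge X s : (acceleration_ratio (X s) <= robustness X)%E.
Proof. exact: le_bigmax. Qed.

(** The hypothesis on [M] has the form given by [ln_1subV_bound] at [z = zeta2 r]; if [ln c < M], it
    yields the steps that [no_descending_steps] forbids. *)
Lemma ln_consistency_ge X r c M d : 4 <= r -> 0 <= d ->
  (robustness X <= r%:E)%E -> (consistency X <= c%:E)%E ->
  (forall x : R, 1 < x -> ln (1 - x^-1) <=
     ln x / (2 ^ k)%:R - M + d * (ln x - ln (zeta2 r))) ->
  M <= ln c.
Proof.
move=> r4 d0 Xr /consistency_le Xc hM; rewrite leNgt; apply/negP => cM.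
have Xsr s : (acceleration_ratio (X s) <= r%:E)%E.
  exact: le_trans (robustness_ge X s) Xr.
have st0 : 0 <= start_time X by apply: bigmax_ge_id.
have c1 : 1 <= c.
  have [|s [i iT Tc]] := Xc (start_time X + 1); first by lra.
  have T0 : 0 < start_time X + 1 by lra.
  have Xi := contract_gt0 (X s) i.
  rewrite -(ler_pM2r Xi) mul1r (le_trans _ Tc)// (le_trans _ iT)//.
  exact: contract_le_completion.
have c0 : 0 < c by lra.
(* The gap [4 * a] is spent as [2 * a] on enlarging [c] to [c'], at most [a] on [d * e], and [a] on
   the gain per step. *)
pose a := (M - ln c) / 4; have a0 : 0 < a by rewrite /a; lra.
pose c' := c * expR (2 * a).
have e1 : 1 < expR (2 * a) by rewrite expR_gt1; lra.
have cc' : c < c' by rewrite ltr_pMr.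
have lc' : ln c' = ln c + 2 * a by rewrite lnM ?posrE ?expR_gt0// expRK.
have c'1 : 1 < c' by lra.
(* The denominator of [e] is [d + 1] because [d] may be zero. *)
have dpos : 0 < d + 1 by lra.
pose e := a / (d + 1); have e0 : 0 < e by rewrite divr_gt0.
have de : d * e <= a.
  by rewrite /e mulrA ler_pdivrMr// mulrC ler_pM2l//; lra.
have /choice[I IP] s : exists I, forall i, (I <= i)%N ->
    ln (completion (X s) i.+1) - ln (completion (X s) i) <= ln (zeta2 r) + e.
  exact: ln_completion_ratio_eventually_le.
pose B := \big[Num.max/0]_(s : k.-tuple bool) (X s 0%N + X s (I s)).
have BP s : X s 0%N + X s (I s) <= B by apply: (le_bigmax _ _ s).
have B0 : 0 <= B by apply: bigmax_ge_id.
(* For [T >= T1], a contract of length at least [T / c'] is longer than [B], so its index exceeds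
   [I s] and the ratio bound holds at its predecessor. *)
pose T1 := c' * (start_time X + B + 1).
have Bc : B < T1.
  have : 1 * (start_time X + B + 1) < c' * (start_time X + B + 1).
    by rewrite ltr_pM2r//; lra.
  rewrite /T1; lra.
have cardI : #|{: k.-tuple bool}| = (2 ^ k)%N by rewrite card_tuple card_bool.
apply: (@no_descending_steps R (k.-tuple bool : finType)
  (fun s => completion (X s)) r c' T1 a) => //.
- by rewrite cardI expn_gt0.
- by move=> s i; apply: completion_gt0.
- by move=> s; apply: completion_lt.
- by move=> s; apply: completion_unbounded.
- move=> s i; apply: le_trans (acceleration_ratio_le (Xsr s) i) _.
  have [zD zM z1 _ z12] := zeta_props r4.
  by rewrite ler_pM2l ?contract_le_completion//; lra.
- move=> s; rewrite completion0; apply: le_lt_trans Bc; apply: le_trans (BP s).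
  by rewrite lerDl ltW// contract_gt0.
- by lra.
move=> T T1T; have T0 : 0 < T by lra.
have Tc' : start_time X + B + 1 <= T / c'.
  by rewrite ler_pdivlMr 1?mulrC//; lra.
have TE : T * c / c' = T / expR (2 * a).
  by rewrite /c'; field; rewrite !gt_eqF ?expR_gt0.
have Tc : T / c' <= T * c / c'.
  by rewrite ler_pM2r ?invr_gt0; [rewrite ler_peMr// ltW | lra].
(* Interrupting at [T / expR (2 * a)] instead of [T] makes the completion time strictly smaller than
   [T], at the price of [c'] for [c]. *)
have [|s [i iT Tci]] := Xc (T * c / c'); first by lra.
have {}Tci : T <= c' * X s i.
  have c'0 : 0 < c' by lra.
  by move: Tci; rewrite mulrAC mulrC ler_pM2l// ler_pdivrMr// mulrC.
have Ii : (I s < i)%N.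
  rewrite ltnNge; apply/negP => /(contract_le (X s)) XiI.
  have : T / c' <= X s i by rewrite ler_pdivrMr ?(mulrC (X s i))//; lra.
  have := BP s; have := contract_gt0 (X s) 0%N; lra.
case: i Ii => // i Ii in iT Tci *; exists s, i.
set t := completion (X s) i.+1; set t' := completion (X s) i.
have Xi0 := contract_gt0 (X s) i.+1.
have t'0 : 0 < t' := completion_gt0 (X s) i.
have t0 : 0 < t := completion_gt0 (X s) i.+1.
have tE : t = t' + X s i.+1 := completionS (X s) i.
have tt' : 1 < t / t' by rewrite ltr_pdivlMr// mul1r; lra.
split.
- apply: le_lt_trans iT _; rewrite TE ltr_pdivrMr ?expR_gt0//.
  by rewrite ltr_pMr.
- apply: le_trans Tci _; rewrite ler_pM2l; last lra.
  exact: contract_le_completion.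
rewrite cardI.
have := hM _ tt'; have := IP s i Ii; rewrite -/t -/t' => Iti.
have q0 : 0 < 1 - (t / t')^-1 by rewrite subr_gt0 invf_lt1// divr_gt0.
have XE : X s i.+1 = t * (1 - (t / t')^-1).
  by rewrite invf_div mulrBr mulr1 mulrC divfK ?gt_eqF// tE; ring.
have : ln T <= ln c' + (ln t + ln (1 - (t / t')^-1)).
  rewrite -!lnM ?posrE ?mulr_gt0//; last lra.
  by rewrite ler_ln ?posrE ?mulr_gt0 -?XE//; lra.
rewrite ln_div ?posrE// lc'.
have : d * (ln t - ln t' - ln (zeta2 r)) <= d * e.
  by rewrite ler_wpM2l//; lra.
rewrite /a in a0 de *; lra.
Qed.

End Advice.

(** * The minimum of the objective and its comparison with the consistency *)

Theorem theorem2 (R : realType) (r : R) (k : nat) (X : advice_schedule R k)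
    (hr : 4 <= r) (hX : (robustness X <= r%:E)%E) :
  exists m : R,
    is_minimum
      [set x ^+ (2 ^ k).+1 / (x ^+ (2 ^ k) - 1) | x in
        [set x : R | zeta1 r `^ (1 / 2 ^+ k) <= x <= zeta2 r `^ (1 / 2 ^+ k)]] m
    /\ (m%:E <= consistency X)%E.
Proof.
have [_ _ z1 z1le2 z12] := zeta_props hr.
have z0 : 0 <= zeta1 r by lra.
have zz0 : 0 <= zeta2 r by lra.
have n0 : (0 < 2 ^ k)%N by rewrite expn_gt0.
have z21 : 1 < zeta2 r by lra.
have [d d0 hM] := ln_1subV_bound z21 n0.
rewrite -natrX; set n := (2 ^ k)%N in n0 hM *.
set u := Num.min _ _ in hM; pose M := ln u / n%:R - ln (1 - u^-1).
have nR0 : 0 < n%:R :> R by rewrite ltr0n.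
have nR_neq0 : n%:R != 0 :> R by rewrite gt_eqF.
have rootK y := @powR_rootK R n y n0.
have e0 : 0 <= 1 / n%:R :> R by rewrite divr_ge0// ltW.
have le2n : 2 <= n.+1%:R :> R by rewrite ler_nat.
(* [zeta1 r <= 2 <= n + 1] keeps the minimizer inside the interval. *)
have u_ge : zeta1 r <= u by rewrite le_min z12; lra.
have u0 : 0 <= u by lra.
(* Written as [x / (1 - (x ^+ n)^-1)], the objective has a logarithm that depends on [x ^+ n] alone,
   in the form bounded by [hM]. *)
have lnF (x : R) : 0 < x -> 1 < x ^+ n -> 0 < x ^+ n.+1 / (x ^+ n - 1) /\
    ln (x ^+ n.+1 / (x ^+ n - 1)) = ln (x ^+ n) / n%:R - ln (1 - (x ^+ n)^-1).
  move=> x0 xn1; have xn0 : 0 < x ^+ n by rewrite exprn_gt0.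
  have q0 : 0 < 1 - (x ^+ n)^-1 by rewrite subr_gt0 invf_lt1.
  have -> : x ^+ n.+1 / (x ^+ n - 1) = x / (1 - (x ^+ n)^-1).
    rewrite exprS; move: (x ^+ n) xn0 xn1 => t t0 t1.
    by field; rewrite !gt_eqF// subr_gt0.
  split; first by rewrite divr_gt0.
  by rewrite ln_div ?posrE// lnXn// -[ln x *+ n]mulr_natr mulfK.
have root_gt0 y : 0 < y -> 0 < y `^ (1 / n%:R) by apply: powR_gt0.
have [||F0 lnFu] := lnF (u `^ (1 / n%:R)).
- by rewrite root_gt0//; lra.
- by rewrite rootK//; lra.
rewrite rootK// in F0 lnFu.
exists ((u `^ (1 / n%:R)) ^+ n.+1 / (u - 1)); split; first split.
- exists (u `^ (1 / n%:R)); rewrite /= ?rootK//.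
  by rewrite !ge0_ler_powR ?nnegrE//= ge_min lexx.
- move=> _ [x /= /andP[x1 x2] <-].
  have x0 : 0 < x by apply: lt_le_trans x1; apply: root_gt0; lra.
  have xn1 : 1 < x ^+ n.
    apply: lt_le_trans z1 _; rewrite -[leLHS]rootK//.
    by rewrite lerXn2r// nnegrE ?powR_ge0 ?ltW.
  have xn2 : x ^+ n <= zeta2 r.
    rewrite -[leRHS]rootK//.
    by rewrite lerXn2r// nnegrE ?powR_ge0 ?ltW.
  have [Fx0 lnFx] := lnF x x0 xn1.
  rewrite -ler_ln ?posrE// lnFu lnFx.
  have := hM _ xn1; rewrite -/M.
  have : d * (ln (x ^+ n) - ln (zeta2 r)) <= 0.
    by rewrite mulr_ge0_le0// subr_le0 ler_ln ?posrE// (lt_trans ltr01).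
  rewrite /M; lra.
rewrite leNgt; apply/negP => Xm.
(* Taking the maximum with half the claimed minimum keeps [c] positive, so that [ln c] can be
   compared. *)
have [c [cX c0 cm]] : exists c : R, [/\ (consistency X <= c%:E)%E, 0 < c &
    c < (u `^ (1 / n%:R)) ^+ n.+1 / (u - 1)].
  move: F0 Xm; move: (_ ^+ n.+1 / _) => m F0.
  case: (consistency X) => [y||] //; last first.
    by move=> _; exists (m / 2); split; [exact: leNye | lra | lra].
  rewrite lte_fin => ym; exists (Num.max y (m / 2)); split.
  - by rewrite lee_fin le_max lexx.
  - by rewrite lt_max; apply/orP; right; lra.
  - by rewrite gt_max ym /=; lra.
have : M <= ln c by exact: ln_consistency_ge hr d0 hX cX hM.
by rewrite /M -lnFu leNgt ltr_ln ?posrE// cm.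
Qed.
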